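(* The following assignments define a $\mathbf{Cat}$-functor (strict 2-functor) $U:\mathbf{ClMulticat}^u\to\mathbf{ClCat}$: a closed multicategory with a unit object is sent to its underlying closed category; a multifunctor $F:\mathsf C\to\mathsf D$ is sent to the closed functor $(\phi,\hat\phi,\phi^0)$, where $\phi$ is the underlying functor of $F$, $\hat\phi_{X,Y}=\underline F_{X;Y}$ is the closing transformation and $\phi^0=\overline{Fu}$; a multinatural transformation is sent to the closed natural transformation given by the same components.
   Context: Composition is written in diagrammatic order: $f\cdot g=g\circ f$. A $\mathbf{Cat}$-functor between 2-categories is a strict 2-functor: it preserves composition of 1-morphisms and identity 1-morphisms on the nose, and all compositions and identities of 2-morphisms. **Closed categories.** A closed category $(\mathcal C,\underline{\mathcal C}(-,-),\mathbf 1,i,j,L)$ consists of a category $\mathcal C$; a functor $\underline{\mathcal C}(-,-):\mathcal C^{op}\times\mathcal C\to\mathcal C$; an object $\mathbf 1$; a natural isomorphism $i_X:X\to\underline{\mathcal C}(\mathbf 1,X)$; a transformation $j_X:\mathbf 1\to\underline{\mathcal C}(X,X)$ dinatural in $X$; a transformation $L^X_{YZ}:\underline{\mathcal C}(Y,Z)\to\underline{\mathcal C}(\underline{\mathcal C}(X,Y),\underline{\mathcal C}(X,Z))$ natural in $Y,Z$ and dinatural in $X$; such that: CC1: $j_Y\cdot L^X_{YY}=j_{\underline{\mathcal C}(X,Y)}$; CC2: $L^X_{XY}\cdot\underline{\mathcal C}(j_X,1)=i_{\underline{\mathcal C}(X,Y)}$; CC3: $L^Y_{UV}\cdot\underline{\mathcal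 C}(1,L^X_{YV})=L^X_{UV}\cdot L^{\underline{\mathcal C}(X,Y)}_{\underline{\mathcal C}(X,U),\underline{\mathcal C}(X,V)}\cdot\underline{\mathcal C}(L^X_{YU},1)$; CC4: $L^{\mathbf 1}_{YZ}\cdot\underline{\mathcal C}(i_Y,1)=\underline{\mathcal C}(1,i_Z)$; CC5: the map $\gamma:\mathcal C(X,Y)\to\mathcal C(\mathbf 1,\underline{\mathcal C}(X,Y))$, $f\mapsto j_X\cdot\underline{\mathcal C}(1,f)$, is a bijection. A closed functor $\Phi=(\phi,\hat\phi,\phi^0):\mathcal C\to\mathcal D$ consists of a functor $\phi$, a natural transformation $\hat\phi_{X,Y}:\phi\underline{\mathcal C}(X,Y)\to\underline{\mathcal D}(\phi X,\phi Y)$ and a morphism $\phi^0:\mathbf 1\to\phi\mathbf 1$ such that: CF1: $\phi^0\cdot\phi j_X\cdot\hat\phi=j_{\phi X}$; CF2: $\phi i_X\cdot\hat\phi\cdot\underline{\mathcal D}(\phi^0,1)=i_{\phi X}$; CF3: $\phi L^X_{YZ}\cdot\hat\phi\cdot\underline{\mathcal D}(1,\hat\phi)=\hat\phi\cdot L^{\phi X}_{\phi Y,\phi Z}\cdot\underline{\mathcal D}(\hat\phi,1)$. A closed natural transformation $\eta:(\phi,\hat\phi,\phi^0)\to(\psi,\hat\psi,\psi^0)$ is a natural transformation $\eta:\phi\to\psi$ such that: CN1: $\phi^0\cdot\eta_{\mathbf 1}=\psi^0$; CN2: $\hat\phi_{X,Y}\cdot\underline{\mathcal D}(1,\eta_Y)=\eta_{\underline{\mathcal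 C}(X,Y)}\cdot\hat\psi_{X,Y}\cdot\underline{\mathcal D}(\eta_X,1)$. These form a 2-category $\mathbf{ClCat}$. The composite of $\Phi:\mathcal C\to\mathcal D$ and $\Psi:\mathcal D\to\mathcal E$ is $(\psi\phi,\ \psi\hat\phi\cdot\hat\psi,\ \psi^0\cdot\psi\phi^0)$; closed natural transformations are composed in the usual way. **Closed multicategories.** A multicategory $\mathsf C$ has objects, sets $\mathsf C(X_1,\dots,X_n;Y)$ ($n\ge0$) of morphisms $X_1,\dots,X_n\to Y$ (written $()\to Y$ if $n=0$), identities $1_X\in\mathsf C(X;X)$ and an associative unital composition $(f_1,\dots,f_n,g)\mapsto(f_1,\dots,f_n)\cdot g$. A multifunctor is a map on objects and morphisms preserving composition and identities; a multinatural transformation $r:F\to G:\mathsf C\to\mathsf D$ is a family $r_X\in\mathsf D(FX;GX)$ with $Ff\cdot r_Y=(r_{X_1},\dots,r_{X_n})\cdot Gf$ for all $f:X_1,\dots,X_n\to Y$. $\mathsf C$ is closed if for all $m\ge0$ and objects $X_1,\dots,X_m,Z$ there are an object $\underline{\mathsf C}(X_1,\dots,X_m;Z)$ and a morphism $\mathrm{ev}:X_1,\dots,X_m,\underline{\mathsf C}(X_1,\dots,X_m;Z)\to Z$ such that for all $n\ge 0$ and $Y_1,\dots,Y_n$ the map $\mathsf C(Y_1,\dots,Y_n;\underline{\mathsf C}(X_1,\dots,X_m;Z))\to\mathsf C(X_1,\dots,X_m,Y_1,\dots,Y_n;Z)$, $f\mapsto(1_{X_1},\dots,1_{X_m},f)\cdot\mathrm{ev}$,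 is a bijection. Such choices are fixed for each closed multicategory, with $\underline{\mathsf C}(;Z)=Z$ and $\mathrm{ev}_{;Z}=1_Z$. Derived morphisms: for $f:()\to Y$, $\underline{\mathsf C}(f;Z)=(f,1)\cdot\mathrm{ev}_{Y;Z}:\underline{\mathsf C}(Y;Z)\to Z$; for $f:X\to Y$, $\underline{\mathsf C}(f;Z)$ is the unique morphism $\underline{\mathsf C}(Y;Z)\to\underline{\mathsf C}(X;Z)$ with $(1_X,\underline{\mathsf C}(f;Z))\cdot\mathrm{ev}_{X;Z}=(f,1)\cdot\mathrm{ev}_{Y;Z}$; for $g:Y\to Z$, $\underline{\mathsf C}(X;g)$ is the unique morphism with $(1_X,\underline{\mathsf C}(X;g))\cdot\mathrm{ev}_{X;Z}=\mathrm{ev}_{X;Y}\cdot g$. The composition $\mu_{\underline{\mathsf C}}:\underline{\mathsf C}(X;Y),\underline{\mathsf C}(Y;Z)\to\underline{\mathsf C}(X;Z)$ is the unique morphism with $(1_X,\mu_{\underline{\mathsf C}})\cdot\mathrm{ev}_{X;Z}=(\mathrm{ev}_{X;Y},1)\cdot\mathrm{ev}_{Y;Z}$, and $1^{\underline{\mathsf C}}_X:()\to\underline{\mathsf C}(X;X)$ is the unique morphism with $(1_X,1^{\underline{\mathsf C}}_X)\cdot\mathrm{ev}_{X;X}=1_X$. A unit object of a closed multicategory $\mathsf C$ is an object $\mathbf 1$ with a morphism $u:()\to\mathbf 1$ such that $\underline{\mathsf C}(u;X):\underline{\mathsf C}(\mathbf 1;X)\to\underline{\mathsf C}(;X)=X$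 is an isomorphism for each $X$. Then each $f:()\to X$ factors as $f=u\cdot\overline f$ for a unique $\overline f:\mathbf 1\to X$. $\mathbf{ClMulticat}^u$ is the 2-category of closed multicategories with a unit object, all multifunctors, and all multinatural transformations. The underlying closed category of $\mathsf C$ is the underlying category of $\mathsf C$ (unary morphisms) with internal Hom-functor $\underline{\mathsf C}(X;Y)$ (on morphisms $f:W\to X$, $g:Y\to Z$: $\underline{\mathsf C}(f;g)=\underline{\mathsf C}(f;Y)\cdot\underline{\mathsf C}(W;g)$), unit object $\mathbf 1$, $i_X=(\underline{\mathsf C}(u;X))^{-1}$, $j_X=\overline{1^{\underline{\mathsf C}}_X}$, and $L^X_{YZ}$ the unique morphism with $(1,L^X_{YZ})\cdot\mathrm{ev}=\mu_{\underline{\mathsf C}}$. The closing transformation $\underline F_{X;Y}:F\underline{\mathsf C}(X;Y)\to\underline{\mathsf D}(FX;FY)$ of a multifunctor $F$ is the unique morphism with $(1_{FX},\underline F_{X;Y})\cdot\mathrm{ev}^{\mathsf D}_{FX;FY}=F\,\mathrm{ev}^{\mathsf C}_{X;Y}$. *)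

(* Defs.v *)
From mathcomp Require Import all_boot boolp.

Set Implicit Arguments.
Unset Strict Implicit.
Unset Printing Implicit Defensive.

(* All compositions are written in diagrammatic order: f ;; g is g after f.    *)
Reserved Notation "f ;; g" (at level 50, left associativity).

Lemma Tagged_inj (I : Type) (P : I -> Type) i (x y : P i) :
  Tagged P x = Tagged P y -> x = y.
Proof.
move=> E; have [e] : exists e : i = i, ecast i (P i) e x = y.
  change (exists e : tag (Tagged P x) = i,
            ecast i (P i) e (tagged (Tagged P x)) = y).
  by rewrite E; exists erefl.
by rewrite (Prop_irrelevance e erefl).
Qed.

(* Equality of 2-cells whose boundary 1-cells are only propositionally equal. *)
Definition heq2 (A : Type) (hom2 : A -> A -> Type)
    (f g f' g' : A) (a : hom2 f g) (b : hom2 f' g') : Prop :=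
  Tagged (fun p : A * A => hom2 p.1 p.2) (a : hom2 (f, g).1 (f, g).2) =
  Tagged (fun p : A * A => hom2 p.1 p.2) (b : hom2 (f', g').1 (f', g').2).

Record two_category := TwoCategory {
  tob :> Type;
  hom1 : tob -> tob -> Type;
  hom2 : forall A B, hom1 A B -> hom1 A B -> Type;
  id1 : forall A, hom1 A A;
  comp1 : forall A B C, hom1 A B -> hom1 B C -> hom1 A C;
  id2 : forall A B (f : hom1 A B), hom2 f f;
  vcomp : forall A B (f g h : hom1 A B), hom2 f g -> hom2 g h -> hom2 f h;
  hcomp : forall A B C (f f' : hom1 A B) (g g' : hom1 B C),
    hom2 f f' -> hom2 g g' -> hom2 (comp1 f g) (comp1 f' g');
  comp1_idl : forall A B (f : hom1 A B), comp1 (id1 A) f = f;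
  comp1_idr : forall A B (f : hom1 A B), comp1 f (id1 B) = f;
  comp1_assoc : forall A B C D (f : hom1 A B) (g : hom1 B C) (h : hom1 C D),
    comp1 f (comp1 g h) = comp1 (comp1 f g) h;
  vcomp_idl : forall A B (f g : hom1 A B) (a : hom2 f g), vcomp (id2 f) a = a;
  vcomp_idr : forall A B (f g : hom1 A B) (a : hom2 f g), vcomp a (id2 g) = a;
  vcomp_assoc : forall A B (f g h k : hom1 A B)
      (a : hom2 f g) (b : hom2 g h) (c : hom2 h k),
    vcomp a (vcomp b c) = vcomp (vcomp a b) c;
  hcomp_id2 : forall A B C (f : hom1 A B) (g : hom1 B C),
    hcomp (id2 f) (id2 g) = id2 (comp1 f g);
  interchange : forall A B C (f f' f'' : hom1 A B) (g g' g'' : hom1 B C)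
      (a : hom2 f f') (a' : hom2 f' f'') (b : hom2 g g') (b' : hom2 g' g''),
    hcomp (vcomp a a') (vcomp b b') = vcomp (hcomp a b) (hcomp a' b');
  hcomp_idl : forall A B (f g : hom1 A B) (a : hom2 f g),
    heq2 (hcomp (id2 (id1 A)) a) a;
  hcomp_idr : forall A B (f g : hom1 A B) (a : hom2 f g),
    heq2 (hcomp a (id2 (id1 B))) a;
  hcomp_assoc : forall A B C D (f f' : hom1 A B) (g g' : hom1 B C)
      (h h' : hom1 C D) (a : hom2 f f') (b : hom2 g g') (c : hom2 h h'),
    heq2 (hcomp a (hcomp b c)) (hcomp (hcomp a b) c)
}.
Arguments hom1 {t}.
Arguments hom2 {t A B}.
Arguments id1 {t}.
Arguments comp1 {t A B C}.
Arguments id2 {t A B}.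
Arguments vcomp {t A B f g h}.
Arguments hcomp {t A B C f f' g g'}.

Record two_functor_data (S T : two_category) := TwoFunctorData {
  tf_ob :> S -> T;
  tf_map1 : forall A B, hom1 A B -> hom1 (tf_ob A) (tf_ob B);
  tf_map2 : forall A B (f g : hom1 A B),
    hom2 f g -> hom2 (tf_map1 f) (tf_map1 g)
}.

Record is_two_functor (S T : two_category) (U : two_functor_data S T) : Prop :=
  IsTwoFunctor {
  tf_id1 : forall A : S, tf_map1 U (id1 A) = id1 (U A);
  tf_comp1 : forall (A B C : S) (f : hom1 A B) (g : hom1 B C),
    tf_map1 U (comp1 f g) = comp1 (tf_map1 U f) (tf_map1 U g);
  tf_id2 : forall (A B : S) (f : hom1 A B),
    tf_map2 U (id2 f) = id2 (tf_map1 U f);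
  tf_vcomp : forall (A B : S) (f g h : hom1 A B) (a : hom2 f g) (b : hom2 g h),
    tf_map2 U (vcomp a b) = vcomp (tf_map2 U a) (tf_map2 U b);
  tf_hcomp : forall (A B C : S) (f f' : hom1 A B) (g g' : hom1 B C)
      (a : hom2 f f') (b : hom2 g g'),
    heq2 (tf_map2 U (hcomp a b)) (hcomp (tf_map2 U a) (tf_map2 U b))
}.

Record category := Category {
  cob :> Type;
  chom : cob -> cob -> Type;
  idc : forall X, chom X X;
  ccomp : forall X Y Z, chom X Y -> chom Y Z -> chom X Z;
  ccomp_idl : forall X Y (f : chom X Y), ccomp (idc X) f = f;
  ccomp_idr : forall X Y (f : chom X Y), ccomp f (idc Y) = f;
  ccompA : forall X Y Z W (f : chom X Y) (g : chom Y Z) (h : chom Z W),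
    ccomp f (ccomp g h) = ccomp (ccomp f g) h
}.
Arguments chom {c}.
Arguments idc {c}.
Arguments ccomp {c X Y Z}.
Notation "f ;; g" := (ccomp f g).

Definition is_inverse (C : category) (X Y : C) (f : chom X Y) (g : chom Y X) :=
  f ;; g = idc X /\ g ;; f = idc Y.

Definition is_iso (C : category) (X Y : C) (f : chom X Y) : Prop :=
  exists g, is_inverse f g.

(* The inverse of an isomorphism, which is unique.                            *)
Definition inv (C : category) (X Y : C) (f : chom X Y) (fP : is_iso f) :
  chom Y X := projT1 (cid fP).

Lemma invP (C : category) (X Y : C) (f : chom X Y) (fP : is_iso f) :
  is_inverse f (inv fP).
Proof. exact: projT2 (cid fP). Qed.

Record functor_data (C D : category) := FunctorData {
  fob :> C -> D;
  fmor : forall X Y : C, chom X Y -> chom (fob X) (fob Y)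
}.
Arguments fmor {C D} f {X Y}.

Record is_functor (C D : category) (F : functor_data C D) : Prop := IsFunctor {
  fmor_id : forall X : C, fmor F (idc X) = idc (F X);
  fmor_comp : forall (X Y Z : C) (f : chom X Y) (g : chom Y Z),
    fmor F (f ;; g) = fmor F f ;; fmor F g
}.

Definition functor_id (C : category) : functor_data C C :=
  {| fob := fun X => X; fmor := fun X Y f => f |}.

Definition functor_comp (C D E : category)
    (F : functor_data C D) (G : functor_data D E) : functor_data C E :=
  {| fob := fun X => G (F X); fmor := fun X Y f => fmor G (fmor F f) |}.

Record closed_category_data := ClosedCategoryData {
  ccat :> category;
  chm : ccat -> ccat -> ccat;
  chmor : forall X X' Y Y' : ccat,
    chom X' X -> chom Y Y' -> chom (chm X Y) (chm X' Y');
  cone : ccat;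
  ci : forall X : ccat, chom X (chm cone X);
  cj : forall X : ccat, chom cone (chm X X);
  cL : forall X Y Z : ccat, chom (chm Y Z) (chm (chm X Y) (chm X Z))
}.
Arguments chm {c}.
Arguments chmor {c X X' Y Y'}.
Arguments cone {c}.
Arguments ci {c}.
Arguments cj {c}.
Arguments cL {c}.

Record is_closed_category (C : closed_category_data) : Prop :=
  IsClosedCategory {
  chmor_id : forall X Y : C, chmor (idc X) (idc Y) = idc (chm X Y);
  chmor_comp : forall (X X' X'' Y Y' Y'' : C) (f : chom X' X) (f' : chom X'' X')
      (g : chom Y Y') (g' : chom Y' Y''),
    chmor (f' ;; f) (g ;; g') = chmor f g ;; chmor f' g';
  ci_iso : forall X : C, is_iso (ci X);
  ci_nat : forall (X Y : C) (f : chom X Y),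
    f ;; ci Y = ci X ;; chmor (idc cone) f;
  cj_dinat : forall (X Y : C) (f : chom X Y),
    cj X ;; chmor (idc X) f = cj Y ;; chmor f (idc Y);
  cL_nat : forall (X Y Y' Z Z' : C) (g : chom Y' Y) (h : chom Z Z'),
    chmor g h ;; cL X Y' Z' =
    cL X Y Z ;; chmor (chmor (idc X) g) (chmor (idc X) h);
  cL_dinat : forall (X X' Y Z : C) (f : chom X X'),
    cL X Y Z ;; chmor (chmor f (idc Y)) (idc (chm X Z)) =
    cL X' Y Z ;; chmor (idc (chm X' Y)) (chmor f (idc Z));
  CC1 : forall X Y : C, cj Y ;; cL X Y Y = cj (chm X Y);
  CC2 : forall X Y : C,
    cL X X Y ;; chmor (cj X) (idc (chm X Y)) = ci (chm X Y);
  CC3 : forall X Y U V : C,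
    cL Y U V ;; chmor (idc (chm Y U)) (cL X Y V) =
    cL X U V ;; cL (chm X Y) (chm X U) (chm X V)
             ;; chmor (cL X Y U) (idc (chm (chm X Y) (chm X V)));
  CC4 : forall Y Z : C,
    cL cone Y Z ;; chmor (ci Y) (idc (chm cone Z)) = chmor (idc Y) (ci Z);
  CC5 : forall X Y : C,
    bijective (fun f : chom X Y => cj X ;; chmor (idc X) f)
}.

Record closed_category := ClosedCategory {
  ccd :> closed_category_data;
  ccP : is_closed_category ccd
}.

Record closed_functor_data (C D : closed_category_data) := ClosedFunctorData {
  cf_fun :> functor_data C D;
  cf_hat : forall X Y : C,
    chom (cf_fun (chm X Y)) (chm (cf_fun X) (cf_fun Y));
  cf_zero : chom cone (cf_fun cone)
}.
Arguments cf_hat {C D}.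
Arguments cf_zero {C D}.

Record is_closed_functor (C D : closed_category_data)
    (F : closed_functor_data C D) : Prop := IsClosedFunctor {
  cf_functor : is_functor F;
  cf_hat_nat : forall (X X' Y Y' : C) (f : chom X' X) (g : chom Y Y'),
    fmor F (chmor f g) ;; cf_hat F X' Y' =
    cf_hat F X Y ;; chmor (fmor F f) (fmor F g);
  CF1 : forall X : C, cf_zero F ;; fmor F (cj X) ;; cf_hat F X X = cj (F X);
  CF2 : forall X : C,
    fmor F (ci X) ;; cf_hat F cone X ;; chmor (cf_zero F) (idc (F X)) =
    ci (F X);
  CF3 : forall X Y Z : C,
    fmor F (cL X Y Z) ;; cf_hat F (chm X Y) (chm X Z)
      ;; chmor (idc (F (chm X Y))) (cf_hat F X Z) =
    cf_hat F Y Z ;; cL (F X) (F Y) (F Z)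
      ;; chmor (cf_hat F X Y) (idc (chm (F X) (F Z)))
}.

Record closed_functor (C D : closed_category_data) := ClosedFunctor {
  cfd :> closed_functor_data C D;
  cfP : is_closed_functor cfd
}.

Record is_closed_nat (C D : closed_category_data)
    (F G : closed_functor_data C D) (eta : forall X : C, chom (F X) (G X)) :
  Prop := IsClosedNat {
  cn_nat : forall (X Y : C) (f : chom X Y),
    fmor F f ;; eta Y = eta X ;; fmor G f;
  CN1 : cf_zero F ;; eta cone = cf_zero G;
  CN2 : forall X Y : C,
    cf_hat F X Y ;; chmor (idc (F X)) (eta Y) =
    eta (chm X Y) ;; cf_hat G X Y ;; chmor (eta X) (idc (G Y))
}.

Record closed_nat (C D : closed_category_data)
    (F G : closed_functor_data C D) := ClosedNat {
  cn :> forall X : C, chom (F X) (G X);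
  cnP : is_closed_nat cn
}.

Lemma closed_functor_eq (C D : closed_category_data) (F G : closed_functor C D) :
  cfd F = cfd G -> F = G.
Proof.
case: F G => F FP [G GP] /= E; case: _ / E in GP *.
by rewrite (Prop_irrelevance FP GP).
Qed.

Lemma closed_nat_eq (C D : closed_category_data) (F G : closed_functor_data C D)
  (r s : closed_nat F G) : (forall X, r X = s X) -> r = s.
Proof.
case: r s => r rP [s sP] /= E; have {}E : r = s by exact: functional_extensionality_dep.
by case: _ / E in sP *; rewrite (Prop_irrelevance rP sP).
Qed.

Lemma closed_nat_heq (C D : closed_category) (F G F' G' : closed_functor C D)
    (r : closed_nat F G) (s : closed_nat F' G') :
  F = F' -> G = G' ->
  (forall X, Tagged (fun p : D * D => chom p.1 p.2)
               (r X : chom (F X, G X).1 (F X, G X).2) =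
             Tagged (fun p : D * D => chom p.1 p.2)
               (s X : chom (F' X, G' X).1 (F' X, G' X).2)) ->
  heq2 (hom2 := fun F G : closed_functor C D => closed_nat F G) r s.
Proof.
move=> E1 E2; case: _ / E1 in s *; case: _ / E2 in s * => E.
congr (Tagged _ _); apply: closed_nat_eq => X.
exact: Tagged_inj (E X).
Qed.

Section ClosedFunctors.
Variables C D E : closed_category.

Definition closed_functor_data_id : closed_functor_data C C :=
  {| cf_fun := functor_id C;
     cf_hat := fun X Y : C => idc (chm X Y);
     cf_zero := idc (cone : C) |}.

Lemma closed_functor_id_subproof : is_closed_functor closed_functor_data_id.
Proof.
have idE (X Y : C) := chmor_id (ccP C) X Y.
split=> //=.
- by move=> X X' Y Y' f g; rewrite ccomp_idr ccomp_idl.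
- by move=> X; rewrite ccomp_idr ccomp_idl.
- by move=> X; rewrite idE !ccomp_idr.
- by move=> X Y Z; rewrite !idE !ccomp_idr ccomp_idl.
Qed.

Definition closed_functor_id : closed_functor C C :=
  ClosedFunctor closed_functor_id_subproof.

Definition closed_functor_data_comp (F : closed_functor_data C D)
    (G : closed_functor_data D E) : closed_functor_data C E :=
  {| cf_fun := functor_comp F G;
     cf_hat := fun X Y : C => fmor G (cf_hat F X Y) ;; cf_hat G (F X) (F Y);
     cf_zero := cf_zero G ;; fmor G (cf_zero F) |}.

Lemma closed_functor_comp_subproof (F : closed_functor C D)
  (G : closed_functor D E) : is_closed_functor (closed_functor_data_comp F G).
Proof.
have [[F1 FM] FN F_1 F_2 F_3] := cfP F.
have [[G1 GM] GN G_1 G_2 G_3] := cfP G.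
have compE (X X' X'' Y Y' Y'' : E) (f : chom X' X) (f' : chom X'' X')
  (g : chom Y Y') (g' : chom Y' Y'') := chmor_comp (ccP E) f f' g g'.
split=> /=.
- split=> /= [X|X Y Z f g]; first by rewrite F1 G1.
  by rewrite FM GM.
- move=> X X' Y Y' f g.
  by rewrite ccompA -GM FN GM -ccompA GN ccompA.
- by move=> X; rewrite !ccompA -(ccompA (cf_zero G)) -GM -(ccompA (cf_zero G)) -GM F_1 G_1.
- move=> X; rewrite -{1}(ccomp_idl (idc (G (F X)))) compE.
  have := GN _ _ _ _ (cf_zero F) (idc (F X)); rewrite G1 => GN'.
  rewrite !ccompA -(ccompA _ (cf_hat G _ _)) -GN' !ccompA -!GM.
  by rewrite F_2 G_2.
- move=> X Y Z.
  rewrite -{1}(ccomp_idl (idc (G (F _)))) compE.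
  have := GN _ _ _ _ (idc (F (chm X Y))) (cf_hat F X Z); rewrite G1 => GN1.
  have := GN _ _ _ _ (cf_hat F X Y) (idc (chm (F X) (F Z))).
  rewrite G1 => GN2.
  rewrite !ccompA -(ccompA _ (cf_hat G _ _)) -GN1 !ccompA -!GM F_3 !GM.
  rewrite -(ccompA _ (fmor G (chmor _ _))) GN2 !ccompA.
  rewrite -(ccompA _ (chmor _ (idc _)) (chmor _ _)) -compE.
  rewrite ccomp_idl -(ccomp_idr (fmor G (cf_hat F X Y))).
  rewrite ccomp_idl -{1}(ccomp_idr (cf_hat G (F X) (F Z))) compE.
  have := G_3 (F X) (F Y) (F Z).
  rewrite !ccompA -2!(ccompA (fmor G (cf_hat F Y Z)) _ _) => ->.
  rewrite !ccompA -(ccompA _ (chmor _ (idc _))) -compE.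
  by rewrite ccomp_idl ccomp_idr.
Qed.

Definition closed_functor_comp (F : closed_functor C D)
  (G : closed_functor D E) : closed_functor C E :=
  ClosedFunctor (closed_functor_comp_subproof F G).

Lemma closed_nat_id_subproof (F : closed_functor C D) :
  is_closed_nat (fun X : C => idc (F X)).
Proof.
have idE (X Y : D) := chmor_id (ccP D) X Y.
split=> [X Y f||X Y]; rewrite ?idE ?ccomp_idl ?ccomp_idr //.
Qed.

Definition closed_nat_id (F : closed_functor C D) : closed_nat F F :=
  ClosedNat (closed_nat_id_subproof F).

Lemma closed_nat_vcomp_subproof (F G H : closed_functor C D)
  (r : closed_nat F G) (s : closed_nat G H) :
  is_closed_nat (fun X : C => r X ;; s X).
Proof.
have compE (X X' X'' Y Y' Y'' : D) (f : chom X' X) (f' : chom X'' X')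
  (g : chom Y Y') (g' : chom Y' Y'') := chmor_comp (ccP D) f f' g g'.
have [rN r1 r2] := cnP r; have [sN s1 s2] := cnP s.
split=> [X Y f||X Y].
- by rewrite ccompA rN -ccompA sN ccompA.
- by rewrite ccompA r1 s1.
- rewrite -{1}(ccomp_idl (idc (F X))) compE ccompA r2 -ccompA -compE.
  rewrite !ccomp_idl -{1}(ccomp_idr (r X)) -{1}(ccomp_idr (s Y)).
  rewrite compE !ccompA -(ccompA (r _)) s2 !ccompA -(ccompA _ _ (chmor (r X) _)).
  by rewrite -compE ccomp_idl.
Qed.

Definition closed_nat_vcomp (F G H : closed_functor C D)
  (r : closed_nat F G) (s : closed_nat G H) : closed_nat F H :=
  ClosedNat (closed_nat_vcomp_subproof r s).

Lemma closed_nat_hcomp_subproof (F F' : closed_functor C D)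
  (G G' : closed_functor D E) (r : closed_nat F F') (s : closed_nat G G') :
  @is_closed_nat _ _ (closed_functor_comp F G) (closed_functor_comp F' G')
    (fun X : C => fmor G (r X) ;; s (F' X)).
Proof.
have compE (X X' X'' Y Y' Y'' : E) (f : chom X' X) (f' : chom X'' X')
  (g : chom Y Y') (g' : chom Y' Y'') := chmor_comp (ccP E) f f' g g'.
have [rN r1 r2] := cnP r; have [sN s1 s2] := cnP s.
have [[G1 GM] GN _ _ _] := cfP G.
split=> [X Y f||X Y] /=.
- by rewrite ccompA -GM rN GM -ccompA sN ccompA.
- by rewrite ccompA -(ccompA (cf_zero G)) -GM r1 -ccompA sN ccompA s1.
- rewrite -{1}(ccomp_idl (idc (G (F X)))) compE.
  have := GN _ _ _ _ (idc (F X)) (r Y); rewrite G1 => GN1.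
  have := GN _ _ _ _ (r X) (idc (F' Y)); rewrite G1 => GN2.
  rewrite !ccompA -(ccompA _ (cf_hat G _ _)) -GN1 !ccompA -GM r2 !GM.
  rewrite -(ccompA _ _ (cf_hat G _ _)) GN2 !ccompA -(ccompA _ _ (chmor _ _)).
  rewrite -compE !ccomp_idl -{1}(ccomp_idr (fmor G (r X))).
  rewrite -{1}(ccomp_idr (s (F' Y))) compE !ccompA.
  rewrite -(ccompA _ (cf_hat G _ _)) s2 !ccompA -(ccompA _ _ (chmor _ _)).
  rewrite -compE ccomp_idl -(ccompA _ (fmor G (cf_hat F' X Y))) sN.
  by rewrite !ccompA.
Qed.

Definition closed_nat_hcomp (F F' : closed_functor C D)
  (G G' : closed_functor D E) (r : closed_nat F F') (s : closed_nat G G') :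
  closed_nat (closed_functor_comp F G) (closed_functor_comp F' G') :=
  ClosedNat (closed_nat_hcomp_subproof r s).

End ClosedFunctors.

Lemma closed_functor_data_eq (C D : closed_category_data) (o : C -> D)
    (m m' : forall X Y : C, chom X Y -> chom (o X) (o Y))
    (h h' : forall X Y : C, chom (o (chm X Y)) (chm (o X) (o Y)))
    (z z' : chom cone (o cone)) :
  (forall X Y (f : chom X Y), m X Y f = m' X Y f) ->
  (forall X Y, h X Y = h' X Y) -> z = z' ->
  @ClosedFunctorData C D (FunctorData m) h z =
  @ClosedFunctorData C D (FunctorData m') h' z'.
Proof.
move=> Em Eh ->.
have -> : m = m' by do 3 apply: functional_extensionality_dep => ?; exact: Em.
have -> // : h = h' by do 2 apply: functional_extensionality_dep => ?.
Qed.

Lemma closed_functor_comp_idl (C D : closed_category) (F : closed_functor C D) :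
  closed_functor_comp (closed_functor_id C) F = F.
Proof.
apply: closed_functor_eq; have [[F1 _] _ _ _ _] := cfP F.
case: F F1 => -[[o m] h z] P /= F1; apply: closed_functor_data_eq => //=.
- by move=> X Y; rewrite F1 ccomp_idl.
- by rewrite F1 ccomp_idr.
Qed.

Lemma closed_functor_comp_idr (C D : closed_category) (F : closed_functor C D) :
  closed_functor_comp F (closed_functor_id D) = F.
Proof.
apply: closed_functor_eq.
case: F => -[[o m] h z] P /=; apply: closed_functor_data_eq => //=.
- by move=> X Y; rewrite ccomp_idr.
- by rewrite ccomp_idl.
Qed.

Lemma closed_functor_comp_assoc (A B C D : closed_category)
  (F : closed_functor A B) (G : closed_functor B C) (H : closed_functor C D) :
  closed_functor_comp F (closed_functor_comp G H) =
  closed_functor_comp (closed_functor_comp F G) H.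
Proof.
apply: closed_functor_eq; have [[_ HM] _ _ _ _] := cfP H.
apply: closed_functor_data_eq => //=.
- by move=> X Y; rewrite HM ccompA.
- by rewrite HM ccompA.
Qed.

Lemma ClCat_vcomp_idl (C D : closed_category) (F G : closed_functor C D)
  (r : closed_nat F G) : closed_nat_vcomp (closed_nat_id F) r = r.
Proof. by apply: closed_nat_eq => X /=; rewrite ccomp_idl. Qed.

Lemma ClCat_vcomp_idr (C D : closed_category) (F G : closed_functor C D)
  (r : closed_nat F G) : closed_nat_vcomp r (closed_nat_id G) = r.
Proof. by apply: closed_nat_eq => X /=; rewrite ccomp_idr. Qed.

Lemma ClCat_vcomp_assoc (C D : closed_category) (F G H K : closed_functor C D)
  (r : closed_nat F G) (s : closed_nat G H) (t : closed_nat H K) :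
  closed_nat_vcomp r (closed_nat_vcomp s t) =
  closed_nat_vcomp (closed_nat_vcomp r s) t.
Proof. by apply: closed_nat_eq => X /=; rewrite ccompA. Qed.

Lemma ClCat_hcomp_id2 (A B C : closed_category)
  (F : closed_functor A B) (G : closed_functor B C) :
  closed_nat_hcomp (closed_nat_id F) (closed_nat_id G) =
  closed_nat_id (closed_functor_comp F G).
Proof.
apply: closed_nat_eq => X /=; have [[G1 _] _ _ _ _] := cfP G.
by rewrite G1 ccomp_idl.
Qed.

Lemma ClCat_interchange (A B C : closed_category)
  (F F' F'' : closed_functor A B) (G G' G'' : closed_functor B C)
  (r : closed_nat F F') (r' : closed_nat F' F'')
  (s : closed_nat G G') (s' : closed_nat G' G'') :
  closed_nat_hcomp (closed_nat_vcomp r r') (closed_nat_vcomp s s') =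
  closed_nat_vcomp (closed_nat_hcomp r s) (closed_nat_hcomp r' s').
Proof.
apply: closed_nat_eq => X /=; have [[_ GM] _ _ _ _] := cfP G.
rewrite GM !ccompA; congr (_ ;; _); rewrite -!ccompA.
by rewrite (cn_nat (cnP s)).
Qed.

Lemma ClCat_hcomp_idl (A B : closed_category) (F G : closed_functor A B)
  (r : closed_nat F G) :
  heq2 (hom2 := fun F G : closed_functor A B => closed_nat F G)
    (closed_nat_hcomp (closed_nat_id (closed_functor_id A)) r) r.
Proof.
apply: closed_nat_heq; try exact: closed_functor_comp_idl.
move=> X /=; have [[F1 _] _ _ _ _] := cfP F.
by congr (Tagged _ _); rewrite /= F1 ccomp_idl.
Qed.

Lemma ClCat_hcomp_idr (A B : closed_category) (F G : closed_functor A B)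
  (r : closed_nat F G) :
  heq2 (hom2 := fun F G : closed_functor A B => closed_nat F G)
    (closed_nat_hcomp r (closed_nat_id (closed_functor_id B))) r.
Proof.
apply: closed_nat_heq; try exact: closed_functor_comp_idr.
by move=> X /=; congr (Tagged _ _); rewrite /= ccomp_idr.
Qed.

Lemma ClCat_hcomp_assoc (A B C D : closed_category)
  (F F' : closed_functor A B) (G G' : closed_functor B C)
  (H H' : closed_functor C D)
  (r : closed_nat F F') (s : closed_nat G G') (t : closed_nat H H') :
  heq2 (hom2 := fun F G : closed_functor A D => closed_nat F G)
    (closed_nat_hcomp r (closed_nat_hcomp s t))
    (closed_nat_hcomp (closed_nat_hcomp r s) t).
Proof.
apply: closed_nat_heq; try exact: closed_functor_comp_assoc.
move=> X /=; have [[_ HM] _ _ _ _] := cfP H.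
by congr (Tagged _ _); rewrite /= HM ccompA.
Qed.

Definition ClCat : two_category := {|
  tob := closed_category;
  hom1 := fun C D => closed_functor C D;
  hom2 := fun C D F G => closed_nat F G;
  id1 := closed_functor_id;
  comp1 := closed_functor_comp;
  id2 := closed_nat_id;
  vcomp := closed_nat_vcomp;
  hcomp := closed_nat_hcomp;
  comp1_idl := closed_functor_comp_idl;
  comp1_idr := closed_functor_comp_idr;
  comp1_assoc := closed_functor_comp_assoc;
  vcomp_idl := ClCat_vcomp_idl;
  vcomp_idr := ClCat_vcomp_idr;
  vcomp_assoc := ClCat_vcomp_assoc;
  hcomp_id2 := ClCat_hcomp_id2;
  interchange := ClCat_interchange;
  hcomp_idl := ClCat_hcomp_idl;
  hcomp_idr := ClCat_hcomp_idr;
  hcomp_assoc := ClCat_hcomp_assoc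
|}.

(* A family of elements of P s_1 t_1, ..., P s_n t_n.                         *)
Inductive hlist (A B : Type) (P : A -> B -> Type) : seq A -> seq B -> Type :=
| hnil : hlist P [::] [::]
| hcons a b s t of P a b & hlist P s t : hlist P (a :: s) (b :: t).
Arguments hnil {A B P}.
Arguments hcons {A B P a b s t}.

Fixpoint hcat (A B : Type) (P : A -> B -> Type) s t s' t'
    (x : hlist P s t) (y : hlist P s' t') : hlist P (s ++ s') (t ++ t') :=
  match x in hlist _ s t return hlist P (s ++ s') (t ++ t') with
  | hnil => y
  | hcons _ _ _ _ p x' => hcons p (hcat x' y)
  end.

Fixpoint hflatten (A B : Type) (P : A -> B -> Type) ss tt
    (x : hlist (hlist P) ss tt) : hlist P (flatten ss) (flatten tt) :=
  match x in hlist _ ss tt return hlist P (flatten ss) (flatten tt) with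
  | hnil => hnil
  | hcons _ _ _ _ p x' => hcat p (hflatten x')
  end.

Fixpoint hmap (A B A' B' : Type) (P : A -> B -> Type) (Q : A' -> B' -> Type)
    (f : A -> A') (g : B -> B') (h : forall a b, P a b -> Q (f a) (g b))
    s t (x : hlist P s t) : hlist Q (map f s) (map g t) :=
  match x in hlist _ s t return hlist Q (map f s) (map g t) with
  | hnil => hnil
  | hcons _ _ _ _ p x' => hcons (h _ _ p) (hmap h x')
  end.

Fixpoint hfam (I A B : Type) (P : A -> B -> Type) (f : I -> A) (g : I -> B)
    (r : forall i, P (f i) (g i)) (s : seq I) : hlist P (map f s) (map g s) :=
  if s is i :: s' then hcons (r i) (hfam r s') else hnil.

Section MultiOperations.
Variables (ob : Type) (hom : seq ob -> ob -> Type).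

(* Equality of morphisms whose sources are only propositionally equal.        *)
Definition meq Xs Xs' Y (f : hom Xs Y) (g : hom Xs' Y) : Prop :=
  Tagged (fun s => hom s Y) f = Tagged (fun s => hom s Y) g.

Fixpoint hids (id : forall X, hom [:: X] X) (Xs : seq ob) :
    hlist hom (map (fun X => [:: X]) Xs) Xs :=
  if Xs is X :: Xs' then hcons (id X) (hids id Xs') else hnil.

Variable comp : forall Xss Ys Z, hlist hom Xss Ys -> hom Ys Z ->
  hom (flatten Xss) Z.

Fixpoint hcomp_fam Xsss Yss Zs (fss : hlist (hlist hom) Xsss Yss) :
    hlist hom Yss Zs -> hlist hom (map flatten Xsss) Zs :=
  match fss in hlist _ Xsss Yss
    return hlist hom Yss Zs -> hlist hom (map flatten Xsss) Zs with
  | hnil => fun gs => gs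
  | hcons Xss Ys Xsss' Yss' fs fss' => fun gs =>
      match gs in hlist _ Yss0 Zs0
        return if Yss0 is Ys0 :: Yss0' then
                 hlist hom Xss Ys0 -> hlist (hlist hom) Xsss' Yss0' ->
                 (forall Zs', hlist hom Yss0' Zs' ->
                    hlist hom (map flatten Xsss') Zs') ->
                 hlist hom (map flatten (Xss :: Xsss')) Zs0
               else unit with
      | hnil => tt
      | hcons _ _ _ _ g gs' => fun fs0 fss0 rec =>
          hcons (comp fs0 g) (rec _ gs')
      end fs fss' (fun Zs' gs' => hcomp_fam fss' gs')
  end.

End MultiOperations.

(* The two equations that the dependent match in [hcomp_fam] implements:
   it maps (fs_1, ..., fs_k) and (g_1, ..., g_k) to (fs_1 . g_1, ..., fs_k . g_k). *)
Lemma hcomp_famE (ob : Type) (hom : seq ob -> ob -> Type)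
    (comp : forall Xss Ys Z, hlist hom Xss Ys -> hom Ys Z -> hom (flatten Xss) Z) :
  hcomp_fam comp hnil hnil = hnil /\
  forall Xss Ys Z Xsss Yss Zs (fs : hlist hom Xss Ys) (g : hom Ys Z)
      (fss : hlist (hlist hom) Xsss Yss) (gs : hlist hom Yss Zs),
    hcomp_fam comp (hcons fs fss) (hcons g gs) =
    hcons (comp _ _ _ fs g) (hcomp_fam comp fss gs).
Proof. by []. Qed.

Record multicategory := Multicategory {
  mob :> Type;
  mhom : seq mob -> mob -> Type;
  mid : forall X, mhom [:: X] X;
  mcomp : forall Xss Ys Z,
    hlist mhom Xss Ys -> mhom Ys Z -> mhom (flatten Xss) Z;
  mcomp_idl : forall Xs Y (f : mhom Xs Y), meq (mcomp (hids mid Xs) f) f;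
  mcomp_idr : forall Xs Y (f : mhom Xs Y), meq (mcomp (hcons f hnil) (mid Y)) f;
  mcompA : forall Xsss Yss Zs W (fss : hlist (hlist mhom) Xsss Yss)
      (gs : hlist mhom Yss Zs) (h : mhom Zs W),
    meq (mcomp (hflatten fss) (mcomp gs h)) (mcomp (hcomp_fam mcomp fss gs) h)
}.
Arguments mhom {m}.
Arguments mid {m}.
Arguments mcomp {m Xss Ys Z}.

Definition mcast (C : multicategory) (Xs Xs' : seq C) (e : Xs = Xs') (Y : C)
    (f : mhom Xs Y) : mhom Xs' Y :=
  ecast s (mhom s Y) e f.

Definition mcomp1 (C : multicategory) (Xs : seq C) (Y Z : C)
    (f : mhom Xs Y) (g : mhom [:: Y] Z) : mhom (flatten [:: Xs]) Z :=
  mcomp (hcons f hnil) g.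

Definition mcomp2 (C : multicategory) (Xs Xs' : seq C) (Y Y' Z : C)
    (f : mhom Xs Y) (f' : mhom Xs' Y') (g : mhom [:: Y; Y'] Z) :
  mhom (flatten [:: Xs; Xs']) Z :=
  mcomp (hcons f (hcons f' hnil)) g.

Record multifunctor (C D : multicategory) := Multifunctor {
  mf_ob :> C -> D;
  mf_hom : forall (Xs : seq C) (Y : C),
    mhom Xs Y -> mhom (map mf_ob Xs) (mf_ob Y);
  mf_id : forall X : C, mf_hom (mid X) = mid (mf_ob X);
  mf_comp : forall (Xss : seq (seq C)) (Ys : seq C) (Z : C)
      (fs : hlist mhom Xss Ys) (g : mhom Ys Z),
    meq (mf_hom (mcomp fs g)) (mcomp (hmap mf_hom fs) (mf_hom g))
}.
Arguments mf_hom {C D} m {Xs Y}.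

Definition is_multinat (C D : multicategory) (F G : multifunctor C D)
    (r : forall X : C, mhom [:: F X] (G X)) : Prop :=
  forall (Xs : seq C) (Y : C) (f : mhom Xs Y),
    meq (mcomp1 (mf_hom F f) (r Y)) (mcomp (hfam r Xs) (mf_hom G f)).

Record multinat (C D : multicategory) (F G : multifunctor C D) := Multinat {
  mn :> forall X : C, mhom [:: F X] (G X);
  mnP : is_multinat mn
}.

Definition heqh (A B : Type) (P : A -> B -> Type) s t s' t'
    (x : hlist P s t) (y : hlist P s' t') : Prop :=
  Tagged (fun p : seq A * seq B => hlist P p.1 p.2) (x : hlist P (s, t).1 (s, t).2) =
  Tagged (fun p : seq A * seq B => hlist P p.1 p.2) (y : hlist P (s', t').1 (s', t').2).

Lemma hcat_nil (A B : Type) (P : A -> B -> Type) s t (x : hlist P s t) :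
  heqh (hcat x hnil) x.
Proof.
elim: x => //= a b s' t' p x IH.
exact: (congr1 (fun z : {q & hlist P q.1 q.2} =>
  Tagged (fun p : seq A * seq B => hlist P p.1 p.2)
   (hcons p (tagged z) : hlist P (a :: (tag z).1, b :: (tag z).2).1
                              (a :: (tag z).1, b :: (tag z).2).2)) IH).
Qed.

Section MultiTheory.
Variable C : multicategory.

Lemma meq_eq (Xs : seq C) (Y : C) (f g : mhom Xs Y) : meq f g -> f = g.
Proof. exact: Tagged_inj. Qed.

Lemma meq_trans (Xs Xs' Xs'' : seq C) (Y : C) (f : mhom Xs Y)
    (g : mhom Xs' Y) (h : mhom Xs'' Y) : meq f g -> meq g h -> meq f h.
Proof. exact: etrans. Qed.

Lemma meq_src (Xs Xs' : seq C) (Y : C) (f : mhom Xs Y) (g : mhom Xs' Y) :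
  meq f g -> Xs = Xs'.
Proof. exact: (congr1 (@tag _ _)). Qed.

Lemma meq_cast (Xs Xs' : seq C) (e : Xs = Xs') (Y : C) (f : mhom Xs Y) :
  meq (mcast e f) f.
Proof. by case: _ / e. Qed.

Lemma mcast_id (Xs : seq C) (e : Xs = Xs) (Y : C) (f : mhom Xs Y) :
  mcast e f = f.
Proof. exact/meq_eq/meq_cast. Qed.

Lemma hcons_congr (Xs Xs' : seq C) (Y : C) (f : mhom Xs Y) (f' : mhom Xs' Y)
    Xss Ys Xss' Ys' (x : hlist mhom Xss Ys) (x' : hlist mhom Xss' Ys') :
  meq f f' -> heqh x x' -> heqh (hcons f x) (hcons f' x').
Proof.
move=> E1 E2; have e1 := meq_src E1; case: _ / e1 in f' E1 *.
have [e2 e3] := congr1 (@tag _ _) E2.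
case: _ / e2 in x' E2 *; case: _ / e3 in x' E2 *.
by rewrite (Tagged_inj E1) (Tagged_inj E2).
Qed.

Lemma mcomp_congr Xss Ys Xss' Ys' (Z : C) (x : hlist mhom Xss Ys)
    (x' : hlist mhom Xss' Ys') (g : mhom Ys Z) (g' : mhom Ys' Z) :
  heqh x x' -> meq g g' -> meq (mcomp x g) (mcomp x' g').
Proof.
move=> E2 E1; have [e2 e3] := congr1 (@tag _ _) E2.
case: _ / e2 in x' E2 *; case: _ / e3 in x' g' E1 E2 *.
by rewrite (Tagged_inj E1) (Tagged_inj E2).
Qed.

Lemma mcomp1A (Xs : seq C) (Y Z W : C) (f : mhom Xs Y) (g : mhom [:: Y] Z)
    (h : mhom [:: Z] W) :
  meq (mcomp1 f (mcomp1 g h)) (mcomp1 (mcomp1 f g) h).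
Proof.
exact: (mcompA (hcons (hcons f hnil) hnil) (hcons g hnil) h).
Qed.

End MultiTheory.

Lemma mf_congr (C D : multicategory) (F : multifunctor C D) (Xs Xs' : seq C)
    (Y : C) (f : mhom Xs Y) (f' : mhom Xs' Y) :
  meq f f' -> meq (mf_hom F f) (mf_hom F f').
Proof.
by move=> E; have e := meq_src E; case: _ / e in f' E *; rewrite (meq_eq E).
Qed.

Lemma mf_comp1 (C D : multicategory) (F : multifunctor C D) (X Y Z : C)
    (f : mhom [:: X] Y) (g : mhom [:: Y] Z) :
  mf_hom F (mcomp1 f g) = mcomp1 (mf_hom F f) (mf_hom F g).
Proof. exact/meq_eq/(mf_comp F (hcons f hnil) g). Qed.

Lemma multifunctor_eq (C D : multicategory) (o : C -> D)
    (m m' : forall Xs Y, mhom Xs Y -> mhom (map o Xs) (o Y)) I I' K K' :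
  (forall Xs Y (f : mhom Xs Y), meq (m Xs Y f) (m' Xs Y f)) ->
  @Multifunctor C D o m I K = @Multifunctor C D o m' I' K'.
Proof.
move=> E; have {}E : m = m'.
  by do 3 apply: functional_extensionality_dep => ?; apply: meq_eq; apply: E.
case: _ / E in I' K' *.
by rewrite (Prop_irrelevance I I') (Prop_irrelevance K K').
Qed.

Lemma multinat_eq (C D : multicategory) (F G : multifunctor C D)
  (r s : multinat F G) : (forall X, r X = s X) -> r = s.
Proof.
case: r s => r rP [s sP] /= E.
have {}E : r = s by exact: functional_extensionality_dep.
by case: _ / E in sP *; rewrite (Prop_irrelevance rP sP).
Qed.

Lemma multinat_heq (C D : multicategory) (F G F' G' : multifunctor C D)
    (r : multinat F G) (s : multinat F' G') :
  F = F' -> G = G' ->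
  (forall X, Tagged (fun p : D * D => mhom [:: p.1] p.2)
               (r X : mhom [:: (F X, G X).1] (F X, G X).2) =
             Tagged (fun p : D * D => mhom [:: p.1] p.2)
               (s X : mhom [:: (F' X, G' X).1] (F' X, G' X).2)) ->
  heq2 (hom2 := fun F G : multifunctor C D => multinat F G) r s.
Proof.
move=> E1 E2; case: _ / E1 in s *; case: _ / E2 in s * => E.
congr (Tagged _ _); apply: multinat_eq => X.
exact: Tagged_inj (E X).
Qed.

Section Multifunctors.
Variables C D E : multicategory.

Let mf_id_hom (Xs : seq C) (Y : C) (f : mhom Xs Y) : mhom (map id Xs) Y :=
  mcast (esym (map_id Xs)) f.

Lemma multifunctor_id_subproof (Xss : seq (seq C)) (Ys : seq C) (Z : C)
    (fs : hlist mhom Xss Ys) (g : mhom Ys Z) :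
  meq (mf_id_hom (mcomp fs g)) (mcomp (hmap mf_id_hom fs) (mf_id_hom g)).
Proof.
apply: etrans (meq_cast _ _) _; apply: mcomp_congr; last first.
  exact/esym/meq_cast.
elim: fs => //= Xs Y Xss' Ys' f fs IH.
by apply: hcons_congr => //; apply/esym/meq_cast.
Qed.

Definition multifunctor_id : multifunctor C C :=
  {| mf_ob := id;
     mf_hom := mf_id_hom;
     mf_id := fun X => mcast_id (esym (map_id [:: X])) (mid X);
     mf_comp := multifunctor_id_subproof |}.

Variables (F : multifunctor C D) (G : multifunctor D E).

Let mf_comp_hom (Xs : seq C) (Y : C) (f : mhom Xs Y) :
    mhom (map (G \o F) Xs) (G (F Y)) :=
  mcast (esym (map_comp G F Xs)) (mf_hom G (mf_hom F f)).

Lemma multifunctor_comp_id_subproof (X : C) :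
  mf_comp_hom (mid X) = mid (G (F X)).
Proof. by rewrite /mf_comp_hom mcast_id !mf_id. Qed.

Lemma multifunctor_comp_subproof (Xss : seq (seq C)) (Ys : seq C) (Z : C)
    (fs : hlist mhom Xss Ys) (g : mhom Ys Z) :
  meq (mf_comp_hom (mcomp fs g)) (mcomp (hmap mf_comp_hom fs) (mf_comp_hom g)).
Proof.
apply: etrans (meq_cast _ _) _.
apply: etrans (mf_congr G (mf_comp F fs g)) _.
apply: etrans (mf_comp G _ _) _.
apply: mcomp_congr; last exact/esym/meq_cast.
elim: fs => //= Xs Y Xss' Ys' f fs IH.
by apply: hcons_congr => //; apply/esym/meq_cast.
Qed.

Definition multifunctor_comp : multifunctor C E :=
  {| mf_ob := G \o F;
     mf_hom := mf_comp_hom;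
     mf_id := multifunctor_comp_id_subproof;
     mf_comp := multifunctor_comp_subproof |}.

End Multifunctors.

Lemma multinat_id_subproof (C D : multicategory) (F : multifunctor C D) :
  @is_multinat C D F F (fun X => mid (F X)).
Proof.
move=> Xs Y f; apply: etrans (mcomp_idr _) _; apply/esym.
apply: etrans (mcomp_idl (mf_hom F f)); apply: mcomp_congr => //.
elim: Xs {f} => //= X Xs IH; exact: hcons_congr.
Qed.

Definition multinat_id (C D : multicategory) (F : multifunctor C D) :
  multinat F F := Multinat (@multinat_id_subproof C D F).

Lemma multinat_vcomp_subproof (C D : multicategory) (F G H : multifunctor C D)
  (r : forall X : C, mhom [:: F X] (G X)) (s : forall X : C, mhom [:: G X] (H X)) :
  is_multinat r -> is_multinat s ->
  @is_multinat C D F H (fun X => mcomp1 (r X) (s X)).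
Proof.
move=> rN sN Xs Y f.
apply: etrans (mcomp1A _ _ _) _.
apply: (meq_trans (g := mcomp1 (mcomp (hfam r Xs) (mf_hom G f)) (s Y))).
  by apply: mcomp_congr => //; apply: hcons_congr => //; apply: rN.
have := mcompA (hcons (hfam r Xs) hnil) (hcons (mf_hom G f) hnil) (s Y).
move/esym => E1; apply: etrans E1 _.
apply: (meq_trans (g := mcomp (hflatten (hfam (fun X => hcons (r X) hnil) Xs))
           (mcomp (hfam s Xs) (mf_hom H f)))).
  apply: mcomp_congr; last exact: sN.
  apply: etrans (hcat_nil _) _.
  elim: Xs {f} => //= X Xs IH; exact: hcons_congr.
apply: meq_trans (mcompA _ _ _) _; apply: mcomp_congr => //.
elim: Xs {f} => //= X Xs IH; exact: hcons_congr.
Qed.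

Definition multinat_vcomp (C D : multicategory) (F G H : multifunctor C D)
    (r : multinat F G) (s : multinat G H) : multinat F H :=
  Multinat (multinat_vcomp_subproof (mnP r) (mnP s)).

Lemma multinat_hcomp_subproof (C D E : multicategory)
  (F F' : multifunctor C D) (G G' : multifunctor D E)
  (r : multinat F F') (s : multinat G G') :
  @is_multinat C E (multifunctor_comp F G) (multifunctor_comp F' G')
    (fun X => mcomp1 (mf_hom G (r X)) (s (F' X))).
Proof.
apply: (@multinat_vcomp_subproof C E (multifunctor_comp F G)
  (multifunctor_comp F' G) (multifunctor_comp F' G')
  (fun X => mf_hom G (r X)) (fun X => s (F' X))) => Xs Y f.
- apply: (meq_trans (g := mcomp1 (mf_hom G (mf_hom F f)) (mf_hom G (r Y)))).
    by apply: mcomp_congr => //; apply: hcons_congr => //; apply: meq_cast.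
  have /esym E1 := mf_comp G (hcons (mf_hom F f) hnil) (r Y).
  apply: etrans E1 _.
  apply: meq_trans (mf_congr G (mnP r f)) _.
  apply: meq_trans (mf_comp G _ _) _.
  apply: mcomp_congr; last exact/esym/meq_cast.
  elim: Xs {f} => //= X Xs IH; exact: hcons_congr.
- apply: (meq_trans (g := mcomp1 (mf_hom G (mf_hom F' f)) (s (F' Y)))).
    by apply: mcomp_congr => //; apply: hcons_congr => //; apply: meq_cast.
  apply: meq_trans (mnP s (mf_hom F' f)) _.
  apply: mcomp_congr; last exact/esym/meq_cast.
  elim: Xs {f} => //= X Xs IH; exact: hcons_congr.
Qed.

Definition multinat_hcomp (C D E : multicategory)
    (F F' : multifunctor C D) (G G' : multifunctor D E)
    (r : multinat F F') (s : multinat G G') :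
  multinat (multifunctor_comp F G) (multifunctor_comp F' G') :=
  Multinat (multinat_hcomp_subproof r s).

Lemma multifunctor_comp_idl (C D : multicategory) (F : multifunctor C D) :
  multifunctor_comp (multifunctor_id C) F = F.
Proof.
have := @mf_congr _ _ F; case: F => o m I K mE.
apply: multifunctor_eq => Xs Y f.
by apply: etrans (meq_cast _ _) _; apply: mE; apply: meq_cast.
Qed.

Lemma multifunctor_comp_idr (C D : multicategory) (F : multifunctor C D) :
  multifunctor_comp F (multifunctor_id D) = F.
Proof.
case: F => o m I K; apply: multifunctor_eq => Xs Y f.
by apply: etrans (meq_cast _ _) _; apply: meq_cast.
Qed.

Lemma multifunctor_comp_assoc (A B C D : multicategory)
  (F : multifunctor A B) (G : multifunctor B C) (H : multifunctor C D) :
  multifunctor_comp F (multifunctor_comp G H) =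
  multifunctor_comp (multifunctor_comp F G) H.
Proof.
apply: multifunctor_eq => Xs Y f /=.
apply: etrans (meq_cast _ _) _; apply: etrans (meq_cast _ _) _; apply/esym.
apply: etrans (meq_cast _ _) _; apply: mf_congr; exact: meq_cast.
Qed.

Section UnderlyingCategory.
Variable C : multicategory.

Lemma ucomp_idl (X Y : C) (f : mhom [:: X] Y) : mcomp1 (mid X) f = f.
Proof. exact/meq_eq/(mcomp_idl f). Qed.

Lemma ucomp_idr (X Y : C) (f : mhom [:: X] Y) : mcomp1 f (mid Y) = f.
Proof. exact/meq_eq/mcomp_idr. Qed.

Lemma ucompA (X Y Z W : C) (f : mhom [:: X] Y) (g : mhom [:: Y] Z)
  (h : mhom [:: Z] W) : mcomp1 f (mcomp1 g h) = mcomp1 (mcomp1 f g) h.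
Proof. exact/meq_eq/mcomp1A. Qed.

Definition ucat : category :=
  {| cob := C;
     chom := fun X Y => mhom [:: X] Y;
     idc := mid;
     ccomp := fun X Y Z f g => mcomp1 f g;
     ccomp_idl := ucomp_idl;
     ccomp_idr := ucomp_idr;
     ccompA := ucompA |}.

End UnderlyingCategory.

Definition ufunctor (C D : multicategory) (F : multifunctor C D) :
    functor_data (ucat C) (ucat D) :=
  {| fob := F : ucat C -> ucat D;
     fmor := fun (X Y : ucat C) (f : chom X Y) => mf_hom F f |}.

Lemma flatten_single_cat (T : Type) (Xs Ys : seq T) :
  flatten (map (fun X => [:: X]) Xs ++ [:: Ys]) = Xs ++ Ys.
Proof. by elim: Xs => [|X Xs IH] /=; rewrite ?cats0 ?IH. Qed.

(* The map f |-> (1_{X_1}, ..., 1_{X_m}, f) . ev; the cast only reassociates the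
   source list.                                                               *)
Definition uncurry_with (C : multicategory) (Xs Ys : seq C) (H Z : C)
    (ev : mhom (Xs ++ [:: H]) Z) (f : mhom Ys H) : mhom (Xs ++ Ys) Z :=
  mcast (flatten_single_cat Xs Ys) (mcomp (hcat (hids mid Xs) (hcons f hnil)) ev).

Record closed_multicategory := ClosedMulticategory {
  cmulti :> multicategory;
  mihom : seq cmulti -> cmulti -> cmulti;
  mev : forall (Xs : seq cmulti) (Z : cmulti), mhom (Xs ++ [:: mihom Xs Z]) Z;
  uncurry_bij : forall (Xs : seq cmulti) (Z : cmulti) (Ys : seq cmulti),
    bijective (uncurry_with (Ys := Ys) (mev Xs Z));
  mihom_nil : forall Z : cmulti, mihom [::] Z = Z;
  mev_nil : forall Z : cmulti, meq (mev [::] Z) (mid Z)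
}.
Arguments mihom {c}.
Arguments mev {c}.

Section ClosedMulticategory.
Variable C : closed_multicategory.

Definition muncurry (Xs Ys : seq C) (Z : C) (f : mhom Ys (mihom Xs Z)) :
  mhom (Xs ++ Ys) Z := uncurry_with (mev Xs Z) f.

Lemma mcurry_ex (Xs Ys : seq C) (Z : C) (g : mhom (Xs ++ Ys) Z) :
  exists f : mhom Ys (mihom Xs Z), muncurry f = g.
Proof. by case: (uncurry_bij Xs Z Ys) => h _ hK; exists (h g); apply: hK. Qed.

Definition mcurry (Xs Ys : seq C) (Z : C) (g : mhom (Xs ++ Ys) Z) :
  mhom Ys (mihom Xs Z) := projT1 (cid (mcurry_ex g)).

Lemma mcurryK (Xs Ys : seq C) (Z : C) (g : mhom (Xs ++ Ys) Z) :
  muncurry (mcurry g) = g.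
Proof. exact: projT2 (cid (mcurry_ex g)). Qed.

Lemma muncurryK (Xs Ys : seq C) (Z : C) (f : mhom Ys (mihom Xs Z)) :
  mcurry (muncurry f) = f.
Proof. by apply: (bij_inj (uncurry_bij Xs Z Ys)); apply: mcurryK. Qed.

(* hom_pre0 f Z, hom_pre f Z and hom_post X g are C(f;Z) for f : () -> Y,
   C(f;Z) for f : X -> Y, and C(X;g). "The unique h with (1, h) . ev = g" is
   rendered as mcurry g throughout.                                           *)
Definition hom_pre0 (Y : C) (f : mhom [::] Y) (Z : C) :
    mhom [:: mihom [:: Y] Z] Z :=
  mcomp2 f (mid _) (mev [:: Y] Z).

Definition hom_pre (X Y : C) (f : mhom [:: X] Y) (Z : C) :
    mhom [:: mihom [:: Y] Z] (mihom [:: X] Z) :=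
  mcurry (Xs := [:: X]) (Ys := [:: mihom [:: Y] Z])
    (mcomp2 f (mid _) (mev [:: Y] Z)).

Definition hom_post (X Y Z : C) (g : mhom [:: Y] Z) :
    mhom [:: mihom [:: X] Y] (mihom [:: X] Z) :=
  mcurry (Xs := [:: X]) (Ys := [:: mihom [:: X] Y])
    (mcomp1 (mev [:: X] Y) g).

Definition hom_mul (X Y Z : C) :
    mhom [:: mihom [:: X] Y; mihom [:: Y] Z] (mihom [:: X] Z) :=
  mcurry (Xs := [:: X]) (Ys := [:: mihom [:: X] Y; mihom [:: Y] Z])
    (mcomp2 (mev [:: X] Y) (mid _) (mev [:: Y] Z)).

Definition hom_unit (X : C) : mhom [::] (mihom [:: X] X) :=
  mcurry (Xs := [:: X]) (Ys := [::]) (mid X).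

End ClosedMulticategory.
Arguments hom_pre {C X Y}.
Arguments hom_pre0 {C Y}.
Arguments hom_post {C} X {Y Z}.
Arguments hom_mul {C}.
Arguments hom_unit {C}.

Record unital_closed_multicategory := UnitalClosedMulticategory {
  ucm :> closed_multicategory;
  mone : ucm;
  mu : mhom [::] mone;
  mu_iso : forall X : ucm, is_iso (C := ucat ucm) (hom_pre0 mu X)
}.
Arguments mone {u}.
Arguments mu {u}.

Lemma mbar_ex (C : unital_closed_multicategory) (X : C) (f : mhom [::] X) :
  exists! g : mhom [:: mone] X, mcomp1 mu g = f.
Proof.
pose P (h : mhom [::] (mihom [:: mone] X)) : mhom [:: mone] X := muncurry h.
have PE h : mcomp1 mu (P h) = mcomp1 h (hom_pre0 mu X).
  have PhE : P h = mcomp (hcons (mid mone) (hcons h hnil)) (mev [:: mone] X).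
    exact: mcast_id.
  apply: meq_eq; rewrite PhE.
  apply: (meq_trans (mcompA (hcons (hcons mu hnil) (hcons hnil hnil))
            (hcons (mid mone) (hcons h hnil)) (mev [:: mone] X))).
  apply: esym.
  apply: (meq_trans (mcompA (hcons hnil (hcons (hcons h hnil) hnil))
            (hcons mu (hcons (mid _) hnil)) (mev [:: mone] X))).
  apply: mcomp_congr => //=; apply: hcons_congr.
    by apply: meq_trans (mcomp_idl mu) _; apply: esym; exact: (mcomp_idr mu).
  apply: hcons_congr => //.
  by apply: meq_trans (mcomp_idr h) _; apply: esym; exact: (mcomp_idl h).
have [v [uv vu]] := mu_iso X.
have PK (g : mhom [:: mone] X) : exists h, P h = g.
  exact: (mcurry_ex (Xs := [:: mone]) (Ys := [::]) g).
have A0 (Y Z : C) (h : mhom [::] X) (a : mhom [:: X] Y) (b : mhom [:: Y] Z) :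
  mcomp1 h (mcomp1 a b) = mcomp1 (mcomp1 h a) b by exact/meq_eq/mcomp1A.
have A1 (Y Z : C) (h : mhom [::] (mihom [:: mone] X)) (a : mhom [:: _] Y)
  (b : mhom [:: Y] Z) :
  mcomp1 h (mcomp1 a b) = mcomp1 (mcomp1 h a) b by exact/meq_eq/mcomp1A.
have I0 (Y : C) (h : mhom [::] Y) : mcomp1 h (mid Y) = h.
  exact/meq_eq/mcomp_idr.
exists (P (mcomp1 f v)); split.
  by rewrite PE -A0 [mcomp1 v _]vu I0.
move=> g; have [h <-] := PK g; rewrite PE => <-.
by rewrite -A1 [mcomp1 _ v]uv I0.
Qed.

(* The unique g : 1 -> X with f = u . g                                        *)
Definition mbar (C : unital_closed_multicategory) (X : C) (f : mhom [::] X) :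
    mhom [:: mone] X :=
  projT1 (cid (mbar_ex f)).

Lemma mbarP (C : unital_closed_multicategory) (X : C) (f : mhom [::] X) :
  unique (fun g : mhom [:: mone] X => mcomp1 mu g = f) (mbar f).
Proof. exact: projT2 (cid (mbar_ex f)). Qed.

Section ClMulticatu.
Implicit Types A B C D : unital_closed_multicategory.

Lemma ClMulticatu_vcomp_idl C D (F G : multifunctor C D) (r : multinat F G) :
  multinat_vcomp (multinat_id F) r = r.
Proof. by apply: multinat_eq => X; apply: ucomp_idl. Qed.

Lemma ClMulticatu_vcomp_idr C D (F G : multifunctor C D) (r : multinat F G) :
  multinat_vcomp r (multinat_id G) = r.
Proof. by apply: multinat_eq => X; apply: ucomp_idr. Qed.

Lemma ClMulticatu_vcomp_assoc C D (F G H K : multifunctor C D)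
  (r : multinat F G) (s : multinat G H) (t : multinat H K) :
  multinat_vcomp r (multinat_vcomp s t) = multinat_vcomp (multinat_vcomp r s) t.
Proof. by apply: multinat_eq => X; apply: ucompA. Qed.

Lemma ClMulticatu_hcomp_id2 A B C (F : multifunctor A B) (G : multifunctor B C) :
  multinat_hcomp (multinat_id F) (multinat_id G) =
  multinat_id (multifunctor_comp F G).
Proof.
apply: multinat_eq => X; change (mcomp1 (mf_hom G (mid (F X))) (mid (G (F X))) = mid (G (F X))).
by rewrite mf_id ucomp_idl.
Qed.

Lemma ClMulticatu_interchange A B C (F F' F'' : multifunctor A B)
  (G G' G'' : multifunctor B C) (r : multinat F F') (r' : multinat F' F'')
  (s : multinat G G') (s' : multinat G' G'') :
  multinat_hcomp (multinat_vcomp r r') (multinat_vcomp s s') =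
  multinat_vcomp (multinat_hcomp r s) (multinat_hcomp r' s').
Proof.
apply: multinat_eq => X.
change (mcomp1 (mf_hom G (mcomp1 (r X) (r' X))) (mcomp1 (s (F'' X)) (s' (F'' X))) =
        mcomp1 (mcomp1 (mf_hom G (r X)) (s (F' X)))
               (mcomp1 (mf_hom G' (r' X)) (s' (F'' X)))).
have sN : mcomp1 (mf_hom G (r' X)) (s (F'' X)) = mcomp1 (s (F' X)) (mf_hom G' (r' X)).
  exact/meq_eq/(mnP s (r' X)).
by rewrite mf_comp1 !ucompA; congr (mcomp1 _ (s' _)); rewrite -!ucompA sN.
Qed.

Lemma ClMulticatu_hcomp_idl A B (F G : multifunctor A B) (r : multinat F G) :
  heq2 (hom2 := fun F G : multifunctor A B => multinat F G)
    (multinat_hcomp (multinat_id (multifunctor_id A)) r) r.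
Proof.
apply: multinat_heq; try exact: multifunctor_comp_idl.
move=> X; congr (Tagged _ _).
change (mcomp1 (mf_hom F (mid X)) (r X) = r X).
by rewrite mf_id ucomp_idl.
Qed.

Lemma ClMulticatu_hcomp_idr A B (F G : multifunctor A B) (r : multinat F G) :
  heq2 (hom2 := fun F G : multifunctor A B => multinat F G)
    (multinat_hcomp r (multinat_id (multifunctor_id B))) r.
Proof.
apply: multinat_heq; try exact: multifunctor_comp_idr.
move=> X; congr (Tagged _ _).
change (mcomp1 (mf_hom (multifunctor_id B) (r X)) (mid (G X)) = r X).
by rewrite ucomp_idr; apply: mcast_id.
Qed.

Lemma ClMulticatu_hcomp_assoc A B C D (F F' : multifunctor A B)
  (G G' : multifunctor B C) (H H' : multifunctor C D)
  (r : multinat F F') (s : multinat G G') (t : multinat H H') :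
  heq2 (hom2 := fun F G : multifunctor A D => multinat F G)
    (multinat_hcomp r (multinat_hcomp s t))
    (multinat_hcomp (multinat_hcomp r s) t).
Proof.
apply: multinat_heq; try exact: multifunctor_comp_assoc.
move=> X; congr (Tagged _ _).
change (mcomp1 (mf_hom (multifunctor_comp G H) (r X))
          (mcomp1 (mf_hom H (s (F' X))) (t (G' (F' X)))) =
        mcomp1 (mf_hom H (mcomp1 (mf_hom G (r X)) (s (F' X)))) (t (G' (F' X)))).
have -> : mf_hom (multifunctor_comp G H) (r X) = mf_hom H (mf_hom G (r X)).
  exact: mcast_id.
by rewrite mf_comp1 ucompA.
Qed.

Definition ClMulticatu : two_category := {|
  tob := unital_closed_multicategory;
  hom1 := fun C D => multifunctor C D;
  hom2 := fun C D F G => multinat F G;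
  id1 := fun C => multifunctor_id C;
  comp1 := fun A B C F G => multifunctor_comp F G;
  id2 := fun C D F => multinat_id F;
  vcomp := fun C D F G H r s => multinat_vcomp r s;
  hcomp := fun A B C F F' G G' r s => multinat_hcomp r s;
  comp1_idl := fun C D F => multifunctor_comp_idl F;
  comp1_idr := fun C D F => multifunctor_comp_idr F;
  comp1_assoc := fun A B C D F G H => multifunctor_comp_assoc F G H;
  vcomp_idl := ClMulticatu_vcomp_idl;
  vcomp_idr := ClMulticatu_vcomp_idr;
  vcomp_assoc := ClMulticatu_vcomp_assoc;
  hcomp_id2 := ClMulticatu_hcomp_id2;
  interchange := ClMulticatu_interchange;
  hcomp_idl := ClMulticatu_hcomp_idl;
  hcomp_idr := ClMulticatu_hcomp_idr;
  hcomp_assoc := ClMulticatu_hcomp_assoc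
|}.

End ClMulticatu.

Definition underlying_closed_data (C : unital_closed_multicategory) :
    closed_category_data :=
  {| ccat := ucat C;
     chm := fun X Y : ucat C => mihom [:: X : C] Y : ucat C;
     chmor := fun (X W Y Z : ucat C) (f : chom W X) (g : chom Y Z) =>
       (hom_pre f Y : chom (mihom [:: X : C] Y : ucat C) (mihom [:: W : C] Y))
         ;; hom_post W g;
     cone := mone : ucat C;
     ci := fun X : ucat C => inv (mu_iso X);
     cj := fun X : ucat C => mbar (hom_unit X);
     cL := fun X Y Z : ucat C =>
       mcurry (Xs := [:: mihom [:: X : C] Y]) (Ys := [:: mihom [:: Y : C] Z])
         (hom_mul X Y Z) |}.

Definition closing (C D : closed_multicategory) (F : multifunctor C D)
    (X Y : C) : mhom [:: F (mihom [:: X] Y)] (mihom [:: F X] (F Y)) :=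
  mcurry (Xs := [:: F X]) (Ys := [:: F (mihom [:: X] Y)])
    (mf_hom F (mev [:: X] Y)).

Definition underlying_functor_data (C D : unital_closed_multicategory)
    (F : multifunctor C D) :
    closed_functor_data (underlying_closed_data C) (underlying_closed_data D) :=
  {| cf_fun := ufunctor F
       : functor_data (underlying_closed_data C) (underlying_closed_data D);
     cf_hat := fun X Y : underlying_closed_data C => closing F X Y;
     cf_zero := mbar (mf_hom F mu) |}.

Definition underlying_nat_data (C D : unital_closed_multicategory)
    (F G : multifunctor C D) (r : multinat F G) (X : underlying_closed_data C) :
    chom (underlying_functor_data F X) (underlying_functor_data G X) :=
  r X.

(* Main.v *)
Require Import Defs.
From mathcomp Require Import all_boot boolp.

Set Implicit Arguments.
Unset Strict Implicit.
Unset Printing Implicit Defensive.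

(** A closed multicategory can be computed in like a (planar) lambda-calculus.
    A generalized element of X is a morphism x : s -> X from an arbitrary
    list s of objects; unary morphisms act on elements by post-composition,
    and an element h of the internal hom C(X;Y) can be applied to an element
    x of X, giving (x, h) . ev.  Two extensionality principles reduce every
    equation of the proposition to an equation between elements:
    - unary morphisms with the same action on elements are equal, since the
      identity is an element ([act_ext]);
    - elements of C(X;Y) that agree when applied to all elements of X are
      equal, since (1, -) . ev is injective ([app_ext]).
    On elements the structure maps become the expected formulas, writing x|h
    for the application of h to x:
      x|(h . C(f;g)) = ((x . f)|h) . g        ([app_pre], [app_post])
      x|1 = x,   x|(h|(k . L)) = (x|h)|k      ([app_unit], [app_cL])
      u|(x . i) = x,   u . j = 1              ([app_u_ci], [act_u_bar])
    and elements of C(1;X) are detected by application to u : () -> 1, while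
    morphisms out of 1 are detected by their action on u.  Each of the axioms
    of a closed category follows by evaluating both sides on elements; CC3,
    for example, says that both sides send x, m, h, k to ((x|m)|h)|k.

    A multifunctor F acts on elements, and its closing transformation, written
    c, is characterized by Fx|(Fh . c) = F(x|h) ([app_closing]).  The identity
    of FX is the image of the identity of X, so elements of the form Fx suffice
    in the extensionality principles, and the axioms of a closed functor are
    again evaluations.  For a multinatural r : F -> G, naturality at ev gives
    (Fx . r)|((Fh . r) . c) = F(x|h) . r ([app_multinat]), which is CN2, and
    naturality at u : () -> 1 is CN1.  Strict 2-functoriality holds because the
    closing transformation of a composite has the defining property of the
    composite of the closing transformations ([closing_comp]), and likewise
    for the comparison of units; on 2-cells both sides have the same
    components. *)

(** * Generalized elements of a closed multicategory *)

Section Elements.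
Variable C : closed_multicategory.

(** The source is packed with the morphism, so that associativity and unit laws,
    which change the source only up to propositional equality, become plain
    equations that can be used for rewriting. *)
Definition elt (X : C) := {s : seq C & mhom s X}.

Definition el (s : seq C) (X : C) (f : mhom s X) : elt X :=
  Tagged (fun s => mhom s X) f.

Definition act (X Y : C) (x : elt X) (f : mhom [:: X] Y) : elt Y :=
  el (mcomp1 (tagged x) f).

Definition act2 (X Y Z : C) (x : elt X) (y : elt Y) (f : mhom [:: X; Y] Z) :
    elt Z :=
  el (mcomp2 (tagged x) (tagged y) f).

Definition app (X Y : C) (x : elt X) (h : elt (mihom [:: X] Y)) : elt Y :=
  act2 x h (mev [:: X] Y).

Lemma el_inj (s : seq C) (X : C) : injective (@el s X).
Proof. exact: meq_eq. Qed.

Lemma act_id (X : C) (x : elt X) : act x (mid X) = x.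
Proof. by case: x => s f; apply: mcomp_idr. Qed.

Lemma act_comp (X Y Z : C) (x : elt X) (f : mhom [:: X] Y) (g : mhom [:: Y] Z) :
  act x (mcomp1 f g) = act (act x f) g.
Proof. exact: mcomp1A. Qed.

Lemma act_mid (X Y : C) (f : mhom [:: X] Y) : act (el (mid X)) f = el f.
Proof. by rewrite /act ucomp_idl. Qed.

Lemma act_ext (X Y : C) (f g : mhom [:: X] Y) :
  (forall x, act x f = act x g) -> f = g.
Proof. by move=> fg; apply: el_inj; rewrite -(act_mid f) -(act_mid g) fg. Qed.

Lemma el_comp0 (X : C) (f : mhom [::] X) : el (mcomp hnil f) = el f.
Proof. exact: (mcomp_idl f). Qed.

Lemma act2_comp (X Y Z W : C) (x : elt X) (y : elt Y)
    (f : mhom [:: X; Y] Z) (g : mhom [:: Z] W) :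
  act2 x y (mcomp1 f g) = act (act2 x y f) g.
Proof.
case: x y => [s x] [t y].
apply: etrans (mcompA (hcons (hcons x (hcons y hnil)) hnil) (hcons f hnil) g).
apply: mcomp_congr => //; apply/esym; exact: hcat_nil.
Qed.

Lemma act2_pre (X X' Y Y' Z : C) (x : elt X) (y : elt Y) (f : mhom [:: X] X')
    (g : mhom [:: Y] Y') (k : mhom [:: X'; Y'] Z) :
  act2 x y (mcomp2 f g k) = act2 (act x f) (act y g) k.
Proof.
case: x y => [s x] [t y].
exact: (mcompA (hcons (hcons x hnil) (hcons (hcons y hnil) hnil))
  (hcons f (hcons g hnil)) k).
Qed.

Lemma act_pre0 (X Y Z : C) (y : elt Y) (f : mhom [::] X)
    (k : mhom [:: X; Y] Z) :
  act y (mcomp2 f (mid Y) k) = act2 (el f) y k.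
Proof.
case: y => [t y].
apply: etrans (mcompA (hcons hnil (hcons (hcons y hnil) hnil))
  (hcons f (hcons (mid Y) hnil)) k) _.
apply: mcomp_congr => //; apply: hcons_congr; first exact: (mcomp_idl f).
by apply: hcons_congr => //; apply: mcomp_idr.
Qed.

(** Substitution into h commutes with uncurrying: this computes the application
    of any composite whose last factor is obtained by currying, whatever the
    number of its inputs. *)
Lemma app_comp (X Z : C) (x : elt X) Xss Ys (fs : hlist mhom Xss Ys)
    (h : mhom Ys (mihom [:: X] Z)) :
  app x (el (mcomp fs h)) = el (mcomp (hcons (tagged x) fs) (muncurry h)).
Proof.
case: x => [s x]; apply/esym.
have E : heqh (hcons x fs)
    (hflatten (hcons (hcons x hnil) (hcons fs hnil))).
  by apply: hcons_congr => //; apply/esym; exact: hcat_nil.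
apply: etrans (mcomp_congr E (meq_cast _ _)) _.
apply: etrans (mcompA (hcons (hcons x hnil) (hcons fs hnil))
  (hcons (mid X) (hcons h hnil)) (mev [:: X] Z)) _.
by apply: mcomp_congr => //; apply: hcons_congr => //; apply: mcomp_idr.
Qed.

(** Applying h to the generic element of X is uncurrying; this turns the
    universal property of the internal hom into extensionality. *)
Lemma app_mid (X Z : C) (s : seq C) (h : mhom s (mihom [:: X] Z)) :
  app (el (mid X)) (el h) = el (muncurry h).
Proof.
have <- : el (mcomp (hids mid s) h) = el h by apply: mcomp_idl.
by rewrite app_comp; apply: (mcomp_idl (muncurry h)).
Qed.

Lemma app_mid_inj (X Z : C) : injective (@app X Z (el (mid X))).
Proof.
move=> [s h] [t k]; rewrite !app_mid => E.
have [e] := congr1 (@tag _ _) E; case: _ / e in k E *.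
congr (Tagged _ _); apply: (bij_inj (uncurry_bij [:: X] Z s)).
exact: el_inj E.
Qed.

Lemma app_ext (X Z : C) (h k : elt (mihom [:: X] Z)) :
  (forall x, app x h = app x k) -> h = k.
Proof. by move=> hk; apply: app_mid_inj; apply: hk. Qed.

Lemma app_mcurry (X Z : C) (x : elt X) Xss Ys (fs : hlist mhom Xss Ys)
    (g : mhom ([:: X] ++ Ys) Z) :
  app x (el (mcomp fs (mcurry (Xs := [:: X]) g))) =
  el (mcomp (hcons (tagged x) fs) g).
Proof. by rewrite app_comp mcurryK. Qed.

Lemma app_act_mcurry (X Y Z : C) (x : elt X) (y : elt Y)
    (g : mhom ([:: X] ++ [:: Y]) Z) :
  app x (act y (mcurry (Xs := [:: X]) g)) = act2 x y g.
Proof. exact: app_mcurry. Qed.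

Lemma app_pre (X X' Y : C) (x : elt X) (h : elt (mihom [:: X'] Y))
    (f : mhom [:: X] X') :
  app x (act h (hom_pre f Y)) = app (act x f) h.
Proof. by rewrite app_act_mcurry act2_pre act_id. Qed.

Lemma act_hom_pre0 (X Y : C) (h : elt (mihom [:: X] Y)) (f : mhom [::] X) :
  act h (hom_pre0 f Y) = app (el f) h.
Proof. exact: act_pre0. Qed.

Lemma app_post (X Y Y' : C) (x : elt X) (h : elt (mihom [:: X] Y))
    (g : mhom [:: Y] Y') :
  app x (act h (hom_post X g)) = act (app x h) g.
Proof. by rewrite app_act_mcurry act2_comp. Qed.

Lemma app_unit (X : C) (x : elt X) : app x (el (hom_unit X)) = x.
Proof. by rewrite -el_comp0 app_mcurry; apply: act_id. Qed.

Lemma app_mul (X Y Z : C) (x : elt X) (h : elt (mihom [:: X] Y))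
    (k : elt (mihom [:: Y] Z)) :
  app x (act2 h k (hom_mul X Y Z)) = app (app x h) k.
Proof.
rewrite app_mcurry; case: x h k => [s x] [t h] [u k].
apply: etrans (mcompA
  (hcons (hcons x (hcons h hnil)) (hcons (hcons k hnil) hnil))
  (hcons (mev [:: X] Y) (hcons (mid _) hnil)) (mev [:: Y] Z)) _.
apply: mcomp_congr => //; apply: hcons_congr => //.
by apply: hcons_congr => //; apply: mcomp_idr.
Qed.

(** A function without parameters acts as its uncurried unary morphism. *)
Lemma act_muncurry (X Y : C) (x : elt X) (h : mhom [::] (mihom [:: X] Y)) :
  act x (muncurry (Xs := [:: X]) h) = app x (el h).
Proof. by rewrite -(el_comp0 h) app_comp. Qed.

End Elements.

(** * The underlying closed category *)

Section UnitalElements.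
Variable C : unital_closed_multicategory.
Local Notation UC := (underlying_closed_data C).

(** Typed by the unit of the underlying closed category, so that the rewriting
    rules below match goals about that category syntactically. *)
Definition uelt : elt ((cone : UC) : C) := el mu.

Lemma actE (X Y Z : UC) (x : elt (X : C)) (f : chom X Y) (g : chom Y Z) :
  act x (f ;; g) = act (act x f) g.
Proof. exact: act_comp. Qed.

Lemma act_idc (X : UC) (x : elt (X : C)) : act x (idc X) = x.
Proof. exact: act_id. Qed.

Lemma app_cL (X Y Z : UC) (x : elt (X : C)) (h : elt (chm X Y : C))
    (k : elt (chm Y Z : C)) :
  app x (app h (act k (cL X Y Z))) = app (app x h) k.
Proof. by rewrite app_act_mcurry app_mul. Qed.

(** C(u;X) is application to u, so its inverse i sends x to the element whose
    value at u is x. *)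
Lemma app_u_ci (X : UC) (x : elt (X : C)) : app uelt (act x (ci X)) = x.
Proof.
rewrite -act_hom_pre0 -act_comp.
have [_ E] := invP (mu_iso X).
by rewrite [X in act x X]E act_id.
Qed.

Lemma app_u_inj (X : UC) (h k : elt (chm cone X : C)) :
  app uelt h = app uelt k -> h = k.
Proof.
rewrite -!act_hom_pre0 => E.
have [E' _] := invP (mu_iso X).
rewrite -(act_id h) -(act_id k) -[mid _]E' !actE.
by rewrite E.
Qed.

Lemma act_u_bar (X : C) (f : mhom [::] X) : act uelt (mbar f) = el f.
Proof. by have [E _] := mbarP f; rewrite -[in RHS]E. Qed.

Lemma act_u_inj (X : C) (f g : mhom [:: (cone : UC) : C] X) :
  act uelt f = act uelt g -> f = g.
Proof.
move=> E'; have E : mcomp1 mu f = mcomp1 mu g by apply: el_inj.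
have [_ U] := mbarP (mcomp1 mu g).
exact: etrans (esym (U f E)) (U g (erefl _)).
Qed.

(** Evaluation of composites of structure maps on elements.  The internal hom
    C(f;g) of two morphisms needs no rule of its own: it is convertible to a
    composite, which actE takes apart. *)
Definition actP := (actE, act_idc, app_post, app_pre, app_cL, app_unit, act_mid,
  app_u_ci, act_u_bar).

Lemma underlying_closed_category : is_closed_category UC.
Proof.
split.
- move=> X Y; apply: act_ext => h; apply: app_ext => x.
  by rewrite !actP.
- move=> X X' X'' Y Y' Y'' f f' g g'; apply: act_ext => h; apply: app_ext => x.
  by rewrite !actP.
- move=> X; exists (hom_pre0 mu X); have [E1 E2] := invP (mu_iso X); by split.
- move=> X Y f; apply: act_ext => x; apply: app_u_inj.
  by rewrite !actP.
- move=> X Y f; apply: act_u_inj; apply: app_ext => x.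
  by rewrite !actP.
- move=> X Y Y' Z Z' g h; apply: act_ext => k; apply: app_ext => m.
  apply: app_ext => x.
  by rewrite !actP.
- move=> X X' Y Z f; apply: act_ext => k; apply: app_ext => m.
  apply: app_ext => x.
  by rewrite !actP.
- move=> X Y; apply: act_u_inj; apply: app_ext => h; apply: app_ext => x.
  by rewrite !actP.
- move=> X Y; apply: act_ext => k; apply: app_u_inj; apply: app_ext => x.
  by rewrite !actP.
- move=> X Y U V; apply: act_ext => k; apply: app_ext => h; apply: app_ext => m.
  apply: app_ext => x.
  by rewrite !actP.
- move=> Y Z; apply: act_ext => k; apply: app_ext => y; apply: app_u_inj.
  by rewrite !actP.
- move=> X Y.
  have E (f : chom X Y) :
      app (el (mid (X : C))) (act uelt (cj X ;; chmor (idc X) f)) = el f.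
    by rewrite !actP.
  (* The inverse sends g to 1|(u . g), the value of the function u . g at the
     generic element of X. *)
  exists (fun g : chom cone (chm X Y) => muncurry (mcomp1 mu g) : chom X Y).
  + move=> f; apply: el_inj; rewrite -app_mid; exact: E.
  + move=> g; apply: act_u_inj; apply: app_ext => x.
    rewrite !actP.
    exact: act_muncurry.
Qed.
End UnitalElements.

(** * The closed functor of a multifunctor *)

Section FunctorElements.
Variables (C D : closed_multicategory) (F : multifunctor C D).

Definition felt (X : C) (x : elt X) : elt (F X) := el (mf_hom F (tagged x)).

Lemma felt_mid (X : C) : felt (el (mid X)) = el (mid (F X)).
Proof. by rewrite /felt mf_id. Qed.

Lemma act_felt (X Y : C) (x : elt X) (f : mhom [:: X] Y) :
  act (felt x) (mf_hom F f) = felt (act x f).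
Proof. exact/esym/mf_comp. Qed.

Lemma act2_felt (X Y Z : C) (x : elt X) (y : elt Y) (f : mhom [:: X; Y] Z) :
  act2 (felt x) (felt y) (mf_hom F f) = felt (act2 x y f).
Proof. exact/esym/mf_comp. Qed.

Lemma app_closing (X Y : C) (x : elt X) (h : elt (mihom [:: X] Y)) :
  app (felt x) (act (felt h) (closing F X Y)) = felt (app x h).
Proof. by rewrite app_act_mcurry act2_felt. Qed.

(** Elements in the image of F suffice to separate morphisms out of F X, as the
    generic element of F X is the image of the generic element of X. *)
Lemma act_felt_ext (X : C) (Y : D) (f g : mhom [:: F X] Y) :
  (forall x, act (felt x) f = act (felt x) g) -> f = g.
Proof. by move=> /(_ (el (mid X))); rewrite felt_mid !act_mid; apply: el_inj. Qed.

Lemma app_felt_ext (X : C) (Y : D) (h k : elt (mihom [:: F X] Y)) :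
  (forall x, app (felt x) h = app (felt x) k) -> h = k.
Proof. by move=> /(_ (el (mid X))); rewrite felt_mid; apply: app_mid_inj. Qed.

End FunctorElements.

Lemma felt_id (C : closed_multicategory) (X : C) (x : elt X) :
  felt (multifunctor_id C) x = x.
Proof. by case: x => s f; apply: meq_cast. Qed.

Lemma felt_comp (C D E : closed_multicategory) (F : multifunctor C D)
    (G : multifunctor D E) (X : C) (x : elt X) :
  felt (multifunctor_comp F G) x = felt G (felt F x).
Proof. exact: meq_cast. Qed.

Lemma closing_id (C : closed_multicategory) (X Y : C) :
  closing (multifunctor_id C) X Y = mid (mihom [:: X] Y).
Proof.
apply: (act_felt_ext (F := multifunctor_id C)) => h.
apply: (app_felt_ext (F := multifunctor_id C)) => x.
by rewrite app_closing act_id !felt_id.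
Qed.

Lemma closing_comp (C D E : closed_multicategory) (F : multifunctor C D)
    (G : multifunctor D E) (X Y : C) :
  closing (multifunctor_comp F G) X Y =
  mcomp1 (mf_hom G (closing F X Y)) (closing G (F X) (F Y)).
Proof.
apply: (act_felt_ext (F := multifunctor_comp F G)) => h.
apply: (app_felt_ext (F := multifunctor_comp F G)) => x.
by rewrite app_closing !felt_comp act_comp -!app_closing -act_felt.
Qed.

Lemma act_u_zero (C D : unital_closed_multicategory) (F : multifunctor C D) :
  act (uelt D) (cf_zero (underlying_functor_data F)) = felt F (uelt C).
Proof. exact: act_u_bar. Qed.

Lemma underlying_closed_functor (C D : unital_closed_multicategory)
    (F : multifunctor C D) : is_closed_functor (underlying_functor_data F).
Proof.
(* The rule for phi^0 comes before actP, whose rule for u . bar f would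
   otherwise rewrite u . phi^0 to a form that is not visibly an image by F. *)
pose rules := (act_u_zero, actP, act_felt, app_closing).
split.
- split=> [X|X Y Z f g]; [exact: mf_id | exact: mf_comp1].
- move=> X X' Y Y' f g; apply: act_felt_ext => h; apply: app_felt_ext => x.
  by rewrite !rules.
- move=> X; apply: act_u_inj; apply: app_felt_ext => x.
  by rewrite !rules.
- move=> X; apply: act_felt_ext => x; apply: app_u_inj.
  by rewrite !rules.
- move=> X Y Z; apply: act_felt_ext => k; apply: app_felt_ext => h.
  apply: app_felt_ext => x.
  by rewrite !rules.
Qed.

(** * The closed natural transformation of a multinatural one *)

Section MultinatElements.
Variables (C D : closed_multicategory) (F G : multifunctor C D).
Variable r : multinat F G.

Lemma act_multinat (X Y : C) (x : elt X) (f : mhom [:: X] Y) :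
  act (act (felt F x) (r X)) (mf_hom G f) = act (felt F (act x f)) (r Y).
Proof.
rewrite -act_felt -!act_comp; congr act.
exact/esym/meq_eq/(mnP r f).
Qed.

Lemma act_multinat0 (X : C) (f : mhom [::] X) :
  act (felt F (el f)) (r X) = felt G (el f).
Proof. by apply: etrans (mnP r f) _; apply: el_comp0. Qed.

(** Naturality of r at the binary evaluation morphism, in terms of elements. *)
Lemma app_multinat (X Y : C) (x : elt X) (h : elt (mihom [:: X] Y)) :
  app (act (felt F x) (r X)) (act (act (felt F h) (r _)) (closing G X Y)) =
  act (felt F (app x h)) (r Y).
Proof.
rewrite app_act_mcurry -act2_pre -act2_felt -act2_comp; congr act2.
exact/esym/meq_eq/(mnP r (mev [:: X] Y)).
Qed.

End MultinatElements.

Lemma underlying_closed_nat (C D : unital_closed_multicategory)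
    (F G : multifunctor C D) (r : multinat F G) :
  is_closed_nat (underlying_nat_data r).
Proof.
split.
- move=> X Y f; apply: act_felt_ext => x.
  by rewrite !(actP, act_multinat, act_felt).
- apply: act_u_inj; rewrite !actP; exact: act_multinat0.
- move=> X Y; apply: act_felt_ext => h; apply: app_felt_ext => x.
  by rewrite !(actP, app_multinat, app_closing).
Qed.

(** * Strict 2-functoriality *)

Lemma underlying_zero_id (C : unital_closed_multicategory) :
  cf_zero (underlying_functor_data (multifunctor_id C)) =
  idc (cone : underlying_closed_data C).
Proof. by apply: act_u_inj; rewrite act_u_zero felt_id act_idc. Qed.

Lemma underlying_zero_comp (C D E : unital_closed_multicategory)
    (F : multifunctor C D) (G : multifunctor D E) :
  cf_zero (underlying_functor_data (multifunctor_comp F G)) =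
  cf_zero (underlying_functor_data G)
    ;; fmor (underlying_functor_data G) (cf_zero (underlying_functor_data F)).
Proof.
by apply: act_u_inj; rewrite act_u_zero actE !(act_u_zero, act_felt) felt_comp.
Qed.

Theorem proposition4p6 :
  exists (obP : forall C : unital_closed_multicategory,
            is_closed_category (underlying_closed_data C))
         (map1P : forall (C D : unital_closed_multicategory)
            (F : multifunctor C D),
            is_closed_functor (underlying_functor_data F))
         (map2P : forall (C D : unital_closed_multicategory)
            (F G : multifunctor C D) (r : multinat F G),
            is_closed_nat (underlying_nat_data r)),
    let U0 (C : ClMulticatu) : ClCat := ClosedCategory (obP C) in
    let U1 (C D : ClMulticatu) (F : hom1 C D) : hom1 (U0 C) (U0 D) :=
      @ClosedFunctor (U0 C) (U0 D) (underlying_functor_data F) (map1P C D F) in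
    let U2 (C D : ClMulticatu) (F G : hom1 C D) (r : hom2 F G) :
        hom2 (U1 C D F) (U1 C D G) :=
      @ClosedNat (U0 C) (U0 D) (U1 C D F) (U1 C D G)
        (underlying_nat_data r) (map2P C D F G r) in
    is_two_functor (@TwoFunctorData ClMulticatu ClCat U0 U1 U2).
Proof.
exists underlying_closed_category, underlying_closed_functor,
  underlying_closed_nat => U0 U1 U2.
have U1_comp (A B C : ClMulticatu) (F : hom1 A B) (G : hom1 B C) :
    U1 A C (comp1 F G) = comp1 (U1 A B F) (U1 B C G).
  apply: closed_functor_eq; apply: closed_functor_data_eq.
  - move=> X Y f; exact: mcast_id.
  - exact: closing_comp.
  - exact: underlying_zero_comp.
split.
- move=> C; apply: closed_functor_eq; apply: closed_functor_data_eq.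
  + move=> X Y f; exact: mcast_id.
  + exact: closing_id.
  + exact: underlying_zero_id.
- exact: U1_comp.
- by move=> C D F; apply: closed_nat_eq.
- by move=> C D F G H r s; apply: closed_nat_eq.
- move=> A B C F F' G G' r s; apply: closed_nat_heq; try exact: U1_comp.
  done.
Qed.
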